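(* (Time-continuous approximation property of learnable latent dynamics models.) Let $\hat{\mathbf{u}}_h$ be the learned time-continuous approximation and $\hat{\mathbf{u}}_h^k$ the learned time-discrete approximation with step $\Delta t$ of the full-order solution $\mathbf{u}_h$ (see context), the latent integration scheme being convergent of order $p$ and the decoder Lipschitz continuous. Put $$E(\Delta t)=\sup_{t_k\in\mathcal{T}_{\Delta t}}\|\mathbf{u}_h(t_k;\boldsymbol{\mu})-\hat{\mathbf{u}}_h^k(\boldsymbol{\mu})\|_{L^\infty(\mathcal{P})},\qquad E(0)=\|\mathbf{u}_h-\hat{\mathbf{u}}_h\|_{L^\infty([0,T]\times\mathcal{P})}.$$ Then $E(\Delta t)\le E(0)+C_2\,\Delta t^p$, with $C_2$ as in the context. Assume that $E(0)$ is bounded. Then for every $\Delta t_{train}>0$ there exists $C=C(\Delta t_{train})>0$ such that $$E(\Delta t)\le E(0)+C_2\,\Delta t_{train}^p=C\,E(\Delta t_{train})\qquad\forall\,\Delta t\le\Delta t_{train}.$$ Moreover, under the perfect embedding assumption (see context), given $\varepsilon>0$, let the dynamics network, the decoder, the encoder and $\Delta t^*$ be those provided for the tolerance $\varepsilon$ by the approximation theorem recalled in the context. Then, taking $\Delta t_{train}\le\Delta t^*$, the time-continuity property $$E(\Delta t)\le C\,E(\Delta t_{train})\le C\varepsilon\qquad\forall\,\Delta t\le\Delta t_{train}$$ holds with $$C=C(\Delta t_{train},T,p)=\big(E(0)+C_2\,\Delta t_{train}^p\big)\,E(\Delta t_{train})^{-1},$$ which is independent of $\Delta t$ (the dependence on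 $T$ being implicit through $C_2$). In particular, $C\to1$ as $\Delta t_{train}\to0$.
   Context: $\mathcal{P}\subset\mathbb{R}^{n_\mu}$ is compact; the time interval is $[0,T]$; $\|\cdot\|$ is the Euclidean norm and $L^\infty$ norms are taken of the Euclidean norm. $\mathbf{u}_h\in C^1([0,T]\times\mathcal{P};\mathbb{R}^{N_h})$ solves, for each $\boldsymbol{\mu}\in\mathcal{P}$, the full-order problem $\dot{\mathbf{u}}_h=\mathbf{f}_h(t,\mathbf{u}_h;\boldsymbol{\mu})$, $\mathbf{u}_h(0;\boldsymbol{\mu})=\mathbf{u}_{0,h}(\boldsymbol{\mu})$. $\mathcal{T}_{\Delta t}=\{t_k\}$ is the discretization of $[0,T]$ with step $\Delta t>0$ and $N_{\Delta t}$ steps. Learned model: neural networks $\Psi_\theta:\mathbb{R}^{N_h}\to\mathbb{R}^n$ (encoder), $\Psi'_\theta:\mathbb{R}^n\to\mathbb{R}^{N_h}$ (decoder), $\mathbf{f}_{n,\theta}$ (latent vector field). The time-continuous approximation is $\hat{\mathbf{u}}_h(t;\boldsymbol{\mu})=\Psi'_\theta(\hat{\mathbf{u}}_n(t;\boldsymbol{\mu}))$, where $\dot{\hat{\mathbf{u}}}_n=\mathbf{f}_{n,\theta}(t,\hat{\mathbf{u}}_n;\boldsymbol{\mu})$, $\hat{\mathbf{u}}_n(0;\boldsymbol{\mu})=\Psi_\theta(\mathbf{u}_{0,h}(\boldsymbol{\mu}))$. The discrete approximation is $\hat{\mathbf{u}}_h^k(\boldsymbol{\mu})=\Psi'_\theta(\hat{\mathbf{u}}_n^k(\boldsymbol{\mu}))$,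 where $\hat{\mathbf{u}}_n^k=\hat{\mathbf{u}}_n^{k-1}+\Delta t\,\Phi(t_{k-1},\hat{\mathbf{u}}_n^{k-1};\Delta t,\mathbf{f}_{n,\theta},\boldsymbol{\mu})$, $\hat{\mathbf{u}}_n^0(\boldsymbol{\mu})=\Psi_\theta(\mathbf{u}_{0,h}(\boldsymbol{\mu}))$, with $\Phi$ the increment function of an explicit Runge-Kutta scheme. Order-$p$ convergence means $\|\hat{\mathbf{u}}_n(t_k;\boldsymbol{\mu})-\hat{\mathbf{u}}_n^k(\boldsymbol{\mu})\|\le C'\Delta t^p$ for all $t_k\in\mathcal{T}_{\Delta t}$ and $\boldsymbol{\mu}\in\mathcal{P}$, with $C'$ independent of $\Delta t$; $C_2=Lip(\Psi'_\theta)\,C'$, where $Lip$ denotes the Lipschitz constant. Perfect embedding assumption: there exists $n^*\ll N_h$ such that for any $n\ge n^*$ there exist $\Psi'\in C^1(\mathbb{R}^n;\mathbb{R}^{N_h})$, $\Psi\in C^1(\mathbb{R}^{N_h};\mathbb{R}^n)$ and a latent dynamics function $\mathbf{f}_n$, Lipschitz in $\mathbf{u}_n$ uniformly in $t$ and Lipschitz in $t$, such that for any $\boldsymbol{\mu}\in\mathcal{P}$: $\mathbf{u}_h(t;\boldsymbol{\mu})=\Psi'(\mathbf{u}_n(t;\boldsymbol{\mu}))$ and $\dot{\mathbf{u}}_n(t;\boldsymbol{\mu})=\mathbf{f}_n(t,\mathbf{u}_n(t;\boldsymbol{\mu});\boldsymbol{\mu})$ for all $t\in(0,T]$, and $\mathbf{u}_n(0;\boldsymbol{\mu})=\Psi(\mathbf{u}_h(0;\boldsymbol{\mu}))$.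 Approximation theorem: under the perfect embedding assumption, for any $\varepsilon>0$ there exist $n>0$, a dynamics network $(t,\boldsymbol{\mu})\mapsto\mathbf{F}_{n,\theta}(t;\boldsymbol{\mu})$ with at most $O(n\varepsilon^{-(n_\mu+1)})$ active weights, a decoder $\Psi'_{n,\theta}:\mathbb{R}^n\to\mathbb{R}^{N_h}$ with at most $O(N_h\varepsilon^{-n})$, an encoder $\Psi_{n,\theta}:\mathbb{R}^{N_h}\to\mathbb{R}^n$ with at most $O(n\varepsilon^{-N_h})$, and $\Delta t^*=\Delta t^*(\mathbf{F}_{n,\theta})$, such that $\sup_k\|\mathbf{u}_h(t_k;\boldsymbol{\mu})-\hat{\mathbf{u}}_h^k(\boldsymbol{\mu})\|\le\varepsilon$ for all $\Delta t\le\Delta t^*$ and $\boldsymbol{\mu}\in\mathcal{P}$, where $\hat{\mathbf{u}}_h^k(\boldsymbol{\mu})=\Psi'_{n,\theta}\big(\Psi_{n,\theta}(\mathbf{u}_{0,h}(\boldsymbol{\mu}))+\Delta t\sum_{j=0}^k w_j\mathbf{F}_{n,\theta}(s_j;\boldsymbol{\mu})\big)$ with $(w_j,s_j)$ quadrature weights and nodes; this explicit form can be traced back to the Runge-Kutta form of the learned model above.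
   Formalization: The existence of C and the time-continuity property are stated for E(Δt_train) ≠ 0 (otherwise C may not exist and the inverse is undefined), and C→1 is stated for E(0) ≠ 0 (if E(0)=0, C may tend to another limit, e.g. when C' is not sharp). *)

(* Defs.v *)
From HB Require Import structures.
From mathcomp Require Import all_boot all_order all_algebra.
From mathcomp Require Import all_classical all_reals all_analysis.

Set Implicit Arguments.
Unset Strict Implicit.
Unset Printing Implicit Defensive.

Import Order.TTheory GRing.Theory Num.Theory.
Import numFieldNormedType.Exports.

Local Open Scope classical_set_scope.
Local Open Scope ring_scope.

Section Euclidean.
Context {R : realType}.

(* The library norm `|x| of 'rV[R]_n is the max norm, hence this definition. *)
Definition enorm n (x : 'rV[R]_n) : R := Num.sqrt (\sum_i x ord0 i ^+ 2).

Definition elipschitz m n (g : 'rV[R]_m -> 'rV[R]_n) : Prop :=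
  exists L : R, forall x y, enorm (g x - g y) <= L * enorm (x - y).

Definition elip_const m n (g : 'rV[R]_m -> 'rV[R]_n) : R :=
  sup [set r | exists x y, x != y /\ r = enorm (g x - g y) / enorm (x - y)].

End Euclidean.

Section LebesgueMeasureRn.
Context {R : realType}.
Local Open Scope ereal_scope.

Definition cons_pair n (z : measurableTypeR R * n.-tuple (measurableTypeR R)) :
  n.+1.-tuple (measurableTypeR R) := [the _.-tuple _ of z.1 :: z.2].

Lemma measurable_cons_pair n : measurable_fun setT (@cons_pair n).
Proof. exact: measurable_cons. Qed.

Definition lebesgue_cons n
    (mu : {sigma_finite_measure set (n.-tuple (measurableTypeR R)) -> \bar R}) :
  set (n.+1.-tuple (measurableTypeR R)) -> \bar R :=
  pushforward (lebesgue_measure \x mu) (@cons_pair n).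

HB.instance Definition _ n mu := Measure.copy (@lebesgue_cons n mu)
  (measure_function_pushforward__canonical__measure_function_Measure
     (lebesgue_measure \x mu) (@measurable_cons_pair n)).

Let lebesgue_cons_sigma_finite n mu : sigma_finite setT (@lebesgue_cons n mu).
Proof.
have /sigma_finiteP[F [FT Fnd Foo]] := sigma_finiteT (@lebesgue_measure R).
have /sigma_finiteP[G [GT Gnd Goo]] := sigma_finiteT mu.
pose u (x : n.+1.-tuple (measurableTypeR R)) :
    measurableTypeR R * n.-tuple (measurableTypeR R) :=
  (thead x, [tuple of behead x]).
have mu_ : measurable_fun setT u.
  by apply: measurable_fun_pair;
    [exact: measurable_tnth|exact: measurable_behead].
have cK z : u (cons_pair z) = z.
  by case: z => a b; rewrite /u /=; congr pair; apply/val_inj.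
exists (fun i => u @^-1` (F i `*` G i)).
  rewrite -preimage_bigcup; apply/esym/seteqP; split => // x _ /=.
  have [i _ Fi] : (\bigcup_i F i) (u x).1 by rewrite -FT.
  have [j _ Gj] : (\bigcup_i G i) (u x).2 by rewrite -GT.
  exists (maxn i j) => //; split => /=.
  - have /subsetPset FS := Fnd _ _ (leq_maxl i j); exact: FS.
  - have /subsetPset GS := Gnd _ _ (leq_maxr i j); exact: GS.
move=> i; have [mF Fi] := Foo i; have [mG Gi] := Goo i; split.
  by rewrite -[X in measurable X]setTI; apply: mu_ => //; exact: measurableX.
rewrite /lebesgue_cons /pushforward.
rewrite (_ : _ @^-1` (u @^-1` _) = F i `*` G i).
  by rewrite product_measure1E// lte_mul_pinfty// ge0_fin_numE.
by apply/funext => z; exact: (congr1 (F i `*` G i) (cK z)).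
Qed.

HB.instance Definition _ n mu := @Measure_isSigmaFinite.Build _ _ _
  (@lebesgue_cons n mu) (@lebesgue_cons_sigma_finite n mu).

(* Lebesgue measure on R^n, as the n-fold product of the one-dimensional one;
   tuples carry the Borel sigma-algebra of R^n, 'rV[R]_n carries none. *)
Fixpoint lebesgue_Rn n :
    {sigma_finite_measure set (n.-tuple (measurableTypeR R)) -> \bar R} :=
  match n with
  | 0%N => \d_([tuple])
  | n'.+1 => [the {sigma_finite_measure set _ -> \bar R} of
      lebesgue_cons (lebesgue_Rn n')]
  end.

End LebesgueMeasureRn.

Section Functions.
Context {R : realType}.

Definition row_of_tuple n (x : n.-tuple (measurableTypeR R)) : 'rV[R]_n :=
  \row_i tnth x i.

(* ||g||_{L^oo(P)}, as the L^oo norm of the extension of g by zero. *)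
Definition Linf_P n m (P : set 'rV[R]_n) (g : 'rV[R]_n -> 'rV[R]_m) : \bar R :=
  Lnorm (lebesgue_Rn n) +oo%E
    (fun x => (((@enorm R m \o g) \_ P) (row_of_tuple x))%:E).

(* ||g||_{L^oo([0,T] x P)} *)
Definition Linf_TP n m (T : R) (P : set 'rV[R]_n)
    (g : R -> 'rV[R]_n -> 'rV[R]_m) : \bar R :=
  Lnorm (lebesgue_measure \x lebesgue_Rn n)%E +oo%E
    (fun z => (((fun y : R * 'rV[R]_n => enorm (g y.1 y.2)) \_
                (`[0, T]%classic `*` P)) (z.1, row_of_tuple z.2))%:E).

(* In finite dimension, continuity of the differential in operator norm
   amounts to continuity of all directional derivatives. *)
Definition C1_open (V W : normedModType R) (U : set V) (f : V -> W) : Prop :=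
  forall x, U x -> differentiable f x /\
                   forall v, {for x, continuous (fun y => 'd f y v)}.

(* C^1 on an arbitrary subset: local restriction of a C^1 function on an open
   neighbourhood. *)
Definition C1_on (V W : normedModType R) (K : set V) (f : V -> W) : Prop :=
  exists (U : set V) (g : V -> W),
    [/\ open U, K `<=` U, C1_open U g & forall x, K x -> f x = g x].

(* Derivative at t relative to [0, T]; one-sided at the end points. *)
Definition has_deriv_on m (T : R) (x : R -> 'rV[R]_m) (t : R) (v : 'rV[R]_m) :=
  (fun s => (s - t)^-1 *: (x s - x t)) @ within `[0, T]%classic t^' --> v.

Definition ivp_solution m (T : R) (f : R -> 'rV[R]_m -> 'rV[R]_m)
    (x0 : 'rV[R]_m) (x : R -> 'rV[R]_m) : Prop :=
  [/\ {within `[0, T]%classic, continuous x},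
      forall t, 0 < t <= T -> has_deriv_on T x t (f t (x t)) & x 0 = x0].

End Functions.

Section NeuralNetworks.
Context {R : realType}.

(* Feed-forward networks acting on row vectors; each hidden layer carries its
   own activation function, applied componentwise. *)
Inductive network : nat -> nat -> Type :=
| Output m k (W : 'M[R]_(m, k)) (b : 'rV[R]_k) : network m k
| Hidden m l k (W : 'M[R]_(m, l)) (b : 'rV[R]_l) (act : R -> R)
    (N : network l k) : network m k.

Fixpoint realize m k (N : network m k) : 'rV[R]_m -> 'rV[R]_k :=
  match N in network m k return 'rV[R]_m -> 'rV[R]_k with
  | Output _ _ W b => fun x => x *m W + b
  | Hidden _ _ _ W b act N' => fun x => realize N' (map_mx act (x *m W + b))
  end.

Definition nb_nonzero m k (A : 'M[R]_(m, k)) : nat :=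
  #|[set ij : 'I_m * 'I_k | A ij.1 ij.2 != 0]%SET|.

Fixpoint active_weights m k (N : network m k) : nat :=
  match N with
  | Output _ _ W b => nb_nonzero W + nb_nonzero b
  | Hidden _ _ _ W b _ N' => nb_nonzero W + nb_nonzero b + active_weights N'
  end.

End NeuralNetworks.
Arguments network : clear implicits.

Section RungeKutta.
Context {R : realType}.

(* Butcher tableau of an explicit scheme: the i-th entry of [rk_rows] is
   (c_i, [:: a_i0; ...; a_i(i-1)]), and [rk_weights] lists the b_i; coefficients
   a_ij with j >= i, if any, are never used. *)
Record explicit_rk := ExplicitRK {
  rk_rows : seq (R * seq R);
  rk_weights : seq R }.

Variables (n : nat) (rk : explicit_rk).
Implicit Type f : R -> 'rV[R]_n -> 'rV[R]_n.

Definition rk_stages f (dt t : R) (x : 'rV[R]_n) : seq 'rV[R]_n :=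
  foldl (fun K row => rcons K (f (t + row.1 * dt)
                 (x + dt *: \sum_(j < size K) row.2`_j *: K`_j)))
        [::] (rk_rows rk).

Definition rk_increment f (dt t : R) (x : 'rV[R]_n) : 'rV[R]_n :=
  \sum_(j < size (rk_rows rk)) (rk_weights rk)`_j *: (rk_stages f dt t x)`_j.

Fixpoint rk_iterate f (x0 : 'rV[R]_n) (dt : R) (k : nat) : 'rV[R]_n :=
  match k with
  | 0%N => x0
  | k'.+1 => let x := rk_iterate f x0 dt k' in
             x + dt *: rk_increment f dt (k'%:R * dt) x
  end.

(* x0 + dt * \sum_j w_j F(s_j) for the composite quadrature rule whose weights
   and nodes on the i-th step are the b_j and t_i + c_j dt. *)
Definition rk_quadrature (F : R -> 'rV[R]_n) (x0 : 'rV[R]_n) (dt : R)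
    (k : nat) : 'rV[R]_n :=
  x0 + dt *: \sum_(i < k) \sum_(j < size (rk_rows rk))
    (rk_weights rk)`_j *: F (i%:R * dt + (nth (0, [::]) (rk_rows rk) j).1 * dt).

Lemma rk_iterate_quadrature f F x0 dt k : (forall t x, f t x = F t) ->
  rk_iterate f x0 dt k = rk_quadrature F x0 dt k.
Proof.
move=> fF.
have stE t x : rk_stages f dt t x = [seq F (t + row.1 * dt) | row <- rk_rows rk].
  rewrite /rk_stages -[RHS]cat0s.
  elim: (rk_rows rk) [::] => [|row s IHs] K /=; first by rewrite cats0.
  by rewrite IHs cat_rcons fF.
elim: k => [|k IHk]; first by rewrite /rk_quadrature big_ord0 scaler0 addr0.
rewrite /= IHk /rk_quadrature big_ord_recr /= scalerDr addrA; congr (_ + _ *: _).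
apply: eq_bigr => j _; rewrite stE (nth_map (0, [::])) //.
Qed.

End RungeKutta.
Arguments explicit_rk : clear implicits.

Section ReducedOrderModel.
Context {R : realType}.
Variables (nmu Nh : nat).
Implicit Types (T dt : R) (P : set 'rV[R]_nmu).

Definition perfect_embedding T P (uh : R -> 'rV[R]_nmu -> 'rV[R]_Nh) : Prop :=
  exists nstar : nat, (0 < nstar < Nh)%N /\
  forall n : nat, (nstar <= n)%N ->
  exists (dec : 'rV[R]_n -> 'rV[R]_Nh) (enc : 'rV[R]_Nh -> 'rV[R]_n)
         (fn : R -> 'rV[R]_n -> 'rV[R]_nmu -> 'rV[R]_n)
         (un : R -> 'rV[R]_nmu -> 'rV[R]_n),
    [/\ C1_open setT dec,
        C1_open setT enc,
        forall mu, P mu -> exists L : R, forall t, 0 <= t <= T -> forall x y,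
          enorm (fn t x mu - fn t y mu) <= L * enorm (x - y),
        forall mu, P mu -> forall x, exists L : R, forall s t,
          0 <= s <= T -> 0 <= t <= T ->
          enorm (fn s x mu - fn t x mu) <= L * `|s - t| &
        forall mu, P mu ->
          (forall t, 0 < t <= T -> uh t mu = dec (un t mu)) /\
          ivp_solution T (fun t x => fn t x mu) (enc (uh 0 mu)) (un ^~ mu)].

Record learned_model (n : nat) := LearnedModel {
  encoder : network R Nh n;
  decoder : network R n Nh;
  latent_field : network R (1 + (n + nmu)) n;
  scheme : explicit_rk R }.

Section Model.
Variables (n : nat) (M : learned_model n).

Definition latent_rhs (mu : 'rV[R]_nmu) (t : R) (x : 'rV[R]_n) : 'rV[R]_n :=
  realize (latent_field M) (row_mx t%:M (row_mx x mu)).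

Definition latent_init (u0h : 'rV[R]_nmu -> 'rV[R]_Nh) (mu : 'rV[R]_nmu) :=
  realize (encoder M) (u0h mu).

Definition latent_discrete u0h dt (k : nat) (mu : 'rV[R]_nmu) : 'rV[R]_n :=
  rk_iterate (scheme M) (latent_rhs mu) (latent_init u0h mu) dt k.

Definition uh_hat (un : R -> 'rV[R]_nmu -> 'rV[R]_n) t mu : 'rV[R]_Nh :=
  realize (decoder M) (un t mu).

Definition uh_hat_discrete u0h dt (k : nat) mu : 'rV[R]_Nh :=
  realize (decoder M) (latent_discrete u0h dt k mu).

End Model.

(* The grid is t_k = k dt for 0 <= k <= nb_steps T dt; dt need not divide T. *)
Definition nb_steps T dt : nat := Num.truncn (T / dt).

Definition convergent_of_order T P u0h n (M : learned_model n)
    (un : R -> 'rV[R]_nmu -> 'rV[R]_n) (p : nat) (C' : R) : Prop :=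
  0 <= C' /\
  forall dt, 0 < dt -> forall k, (k <= nb_steps T dt)%N -> forall mu, P mu ->
    enorm (un (k%:R * dt) mu - latent_discrete M u0h dt k mu) <= C' * dt ^+ p.

Definition err_discrete T P (uh : R -> 'rV[R]_nmu -> 'rV[R]_Nh) u0h n
    (M : learned_model n) dt : \bar R :=
  ereal_sup [set Linf_P P (fun mu => uh (k%:R * dt) mu
                                     - uh_hat_discrete M u0h dt k mu)
            | k in [set k | (k <= nb_steps T dt)%N]].

Definition err_continuous T P (uh : R -> 'rV[R]_nmu -> 'rV[R]_Nh) n
    (M : learned_model n) un : \bar R :=
  Linf_TP T P (fun t mu => uh t mu - uh_hat M un t mu).

Definition time_net_eval n (F : network R (1 + nmu) n) (mu : 'rV[R]_nmu)
  (t : R) : 'rV[R]_n := realize F (row_mx t%:M mu).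

(* What the approximation theorem delivers for the tolerance eps: the dynamics
   network F, the decoder and encoder of M, and the threshold dt_star; c is the
   constant, independent of eps, hidden in the O(.) complexity bounds. *)
Definition approximation_data T P (uh : R -> 'rV[R]_nmu -> 'rV[R]_Nh) u0h
    (c eps : R) n (M : learned_model n) (F : network R (1 + nmu) n)
    (dt_star : R) : Prop :=
  [/\ (active_weights F)%:R <= c * n%:R * eps ^- nmu.+1,
      (active_weights (decoder M))%:R <= c * Nh%:R * eps ^- n,
      (active_weights (encoder M))%:R <= c * n%:R * eps ^- Nh,
      0 < dt_star &
      forall dt, 0 < dt <= dt_star -> forall mu, P mu ->
      forall k, (k <= nb_steps T dt)%N ->
        enorm (uh (k%:R * dt) mu
               - realize (decoder M)
                   (rk_quadrature (scheme M) (time_net_eval F mu)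
                                  (latent_init M u0h mu) dt k)) <= eps].

End ReducedOrderModel.
Arguments learned_model : clear implicits.

(* Main.v *)
Require Import Defs.
From mathcomp Require Import all_boot all_order all_algebra.
From mathcomp Require Import all_classical all_reals all_analysis.
From mathcomp Require Import ess_sup_inf ring lra.

Set Implicit Arguments.
Unset Strict Implicit.
Unset Printing Implicit Defensive.

Import Order.TTheory GRing.Theory Num.Theory.
Import numFieldNormedType.Exports.

Local Open Scope classical_set_scope.
Local Open Scope ring_scope.

(** Write g(t, mu) for the error uh - uh_hat of the time-continuous model, and
    S(dt) for the sup over the grid t_k = k dt of the L^oo(P) norm of g(t_k, .).
    Passing from the continuous to the discrete latent trajectory moves the
    decoded output by at most Lip(decoder) C' dt^p = C2 dt^p at every grid
    point, so E(dt) and S(dt) differ by at most C2 dt^p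
    ([err_discrete_le_grid_sup], [grid_sup_le_err_discrete]). Everything then
    rests on comparing S(dt) with E(0), the L^oo norm of g on [0, T] x P. Since
    these norms only see g up to null sets, a time slice of g is not controlled
    by E(0) for measure-theoretic reasons alone; the continuity of g in time
    makes the difference.

    - S(dt) <= E(0) ([grid_sup_le_Linf_TP]). By Fubini, for almost every mu the
      bound |g(t, mu)| <= E(0) holds for almost every t, hence on a dense set of
      times, hence for all t by continuity. This gives E(dt) <= E(0) + C2 dt^p,
      from which the existence of C and the time-continuity property are
      arithmetic.
    - If r < E(0), then r < S(dt) for all small dt ([grid_sup_near]). Otherwise
      S(dt_j) <= r along a sequence dt_j tending to 0; outside a countable
      union of null sets of parameters, |g| <= r on all these grids at once.
      Their union is dense in [0, T], so |g| <= r almost everywhere, that is,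
      E(0) <= r.

    The two bounds together give E(dt) --> E(0) ([cvg_err_discrete]), hence
    C --> 1 when E(0) is finite and nonzero. *)

(** * Euclidean norm and Lipschitz constants *)

Section EuclideanNorm.
Context {R : realType}.

Lemma enorm_ge0 n (x : 'rV[R]_n) : 0 <= enorm x.
Proof. exact: sqrtr_ge0. Qed.

Lemma sqr_enorm n (x : 'rV[R]_n) : enorm x ^+ 2 = \sum_i x ord0 i ^+ 2.
Proof. by rewrite sqr_sqrtr// sumr_ge0// => i _; exact: sqr_ge0. Qed.

Lemma enorm0 n : enorm (0 : 'rV[R]_n) = 0.
Proof. by rewrite /enorm big1 ?sqrtr0// => i _; rewrite mxE expr0n. Qed.

Lemma enorm_eq0 n (x : 'rV[R]_n) : enorm x = 0 -> x = 0.
Proof.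
move=> x0; have /eqP := sqr_enorm x; rewrite x0 expr0n/= eq_sym psumr_eq0.
  move=> /allP xi0; apply/rowP => i; rewrite mxE.
  by apply/eqP; rewrite -sqrf_eq0; apply: xi0; rewrite mem_index_enum.
by move=> i _; exact: sqr_ge0.
Qed.

Lemma enormN n (x : 'rV[R]_n) : enorm (- x) = enorm x.
Proof.
by rewrite /enorm; congr Num.sqrt; apply: eq_bigr => i _; rewrite mxE sqrrN.
Qed.

(** Summing the convexity inequality
    (u + v)^2 <= (a + b) (u^2 / a + v^2 / b) over the coordinates, with a and b
    the two norms, gives the triangle inequality without Cauchy-Schwarz. *)
Lemma ler_enormD n (x y : 'rV[R]_n) : enorm (x + y) <= enorm x + enorm y.
Proof.
have := enorm_ge0 x; rewrite le_eqVlt => /orP[/eqP/esym x0|x_gt0].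
  by rewrite (enorm_eq0 x0) enorm0 !add0r.
have := enorm_ge0 y; rewrite le_eqVlt => /orP[/eqP/esym y0|y_gt0].
  by rewrite (enorm_eq0 y0) enorm0 !addr0.
set a := enorm x in x_gt0 *; set b := enorm y in y_gt0 *.
rewrite -ler_sqr ?nnegrE ?enorm_ge0 ?addr_ge0 ?enorm_ge0// sqr_enorm.
have -> : (a + b) ^+ 2 =
    \sum_i (a + b) * (x ord0 i ^+ 2 / a + y ord0 i ^+ 2 / b).
  rewrite -mulr_sumr big_split/= -!mulr_suml -!sqr_enorm -/a -/b.
  by field; rewrite !gt_eqF.
apply: ler_sum => i _; rewrite mxE; move: (x ord0 i) (y ord0 i) => u v.
rewrite -subr_ge0.
have -> : (a + b) * (u ^+ 2 / a + v ^+ 2 / b) - (u + v) ^+ 2 =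
    (u * b - v * a) ^+ 2 / (a * b) by field; rewrite !gt_eqF.
by rewrite divr_ge0 ?sqr_ge0// mulr_ge0// ltW.
Qed.

Lemma ler_dist_enorm n (x y : 'rV[R]_n) : `|enorm x - enorm y| <= enorm (x - y).
Proof.
rewrite ler_norml; apply/andP; split.
  rewrite lerNl opprB lerBlDr -(enormN (x - y)) opprB.
  by rewrite (le_trans _ (ler_enormD _ _))// subrK.
by rewrite lerBlDr (le_trans _ (ler_enormD _ _))// subrK.
Qed.

Lemma enorm_continuous n : continuous (@enorm R n).
Proof.
move=> x; apply: (@continuous_comp _ _ _ (fun x : 'rV[R]_n => _) Num.sqrt).
  have -> : (fun y : 'rV[R]_n => \sum_i y ord0 i ^+ 2) =
      \sum_i (fun y : 'rV[R]_n => y ord0 i ^+ 2) by rewrite fct_sumE.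
  elim/big_ind : _ => [|f g fx gx|i _].
  - exact: (@cst_continuous _ _ (0 : R)).
  - exact: continuousD.
  apply: (@continuous_comp _ _ _ (fun y : 'rV[R]_n => y ord0 i)
    (fun z => z ^+ 2)); first exact: coord_continuous.
  exact: exprn_continuous.
exact: sqrt_continuous.
Qed.

Lemma cvg_enorm_dist (U : Type) (F : set_system U) {FF : Filter F} n
    (f : U -> 'rV[R]_n) (l : 'rV[R]_n) :
  f @ F --> l -> enorm (f y - l) @[y --> F] --> 0.
Proof.
move=> fl; rewrite -(@enorm0 n) -(subrr l).
apply: (@cvg_comp _ _ _ (fun y => f y - l) _ _ (nbhs (l - l))).
  by apply: cvgB => //; exact: cvg_cst.
exact: enorm_continuous.
Qed.

Lemma elip_const_ge0 m n (g : 'rV[R]_m -> 'rV[R]_n) : 0 <= elip_const g.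
Proof.
rewrite /elip_const; set S := (X in sup X).
have [[[z Sz] ubS]|/sup_out ->//] := pselect (has_sup S).
apply: le_trans (ub_le_sup ubS Sz); case: Sz => x [y [_ ->]].
by rewrite divr_ge0 ?enorm_ge0.
Qed.

(** The supremum defining the constant is taken over distinct points, and it
    is finite because some Lipschitz bound exists. *)
Lemma elip_constP m n (g : 'rV[R]_m -> 'rV[R]_n) : elipschitz g ->
  forall x y, enorm (g x - g y) <= elip_const g * enorm (x - y).
Proof.
move=> [L gL] x y; have [->|xy] := eqVneq x y.
  by rewrite !subrr !enorm0 mulr0.
have pos u v : u != v -> 0 < enorm (u - v :> 'rV[R]_m).
  move=> uv; rewrite lt_neqAle enorm_ge0 andbT eq_sym.
  by apply: contra uv => /eqP/enorm_eq0/eqP; rewrite subr_eq0.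
rewrite -ler_pdivrMr ?pos//; apply: ub_le_sup; last by exists x, y.
by exists L => _ [u [v [uv ->]]]; rewrite ler_pdivrMr ?pos.
Qed.

Lemma elipschitz_cvg_dist (U : Type) (F : set_system U) {FF : Filter F} m n
    (g : 'rV[R]_m -> 'rV[R]_n) (f : U -> 'rV[R]_m) (l : 'rV[R]_m) :
  elipschitz g -> f @ F --> l -> enorm (g (f y) - g l) @[y --> F] --> 0.
Proof.
move=> gL fl.
apply: (@squeeze_cvgr _ _ _ _ (cst 0)
  (fun y => elip_const g * enorm (f y - l))).
- by apply: nearW => y; rewrite enorm_ge0 elip_constP.
- exact: cvg_cst.
- rewrite -[X in _ --> X](mulr0 (elip_const g)); apply: cvgM.
    exact: cvg_cst.
  exact: cvg_enorm_dist.
Qed.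

End EuclideanNorm.

(** * Essential suprema and null sets in products *)

Section EssentialBounds.
Context {R : realType}.

(** The reparametrization [phi] is there because the measures live on tuples,
    whereas the functions to be bounded take row vectors. *)
Lemma Lnorm_oo_restrict_le d (S : measurableType d)
    (m : {measure set S -> \bar R}) (V : Type) (A : set V) (phi : S -> V)
    (f : V -> R) (r : R) :
  (0 < m setT)%E -> (forall v, 0 <= f v) -> 0 <= r ->
  (Lnorm m +oo%E (fun x => ((f \_ A) (phi x))%:E) <= r%:E)%E <->
  {ae m, forall x, A (phi x) -> f (phi x) <= r}.
Proof.
move=> m0 f0 r0; rewrite unlock m0.
have fE x : (`|((f \_ A) (phi x))%:E| <= r%:E)%E <->
    (A (phi x) -> f (phi x) <= r).
  rewrite patchE; case: ifPn => /= [/set_mem|/negP] Ax.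
    by rewrite lee_fin ger0_norm//; split=> // /(_ Ax).
  by rewrite lee_fin normr0 r0; split => // _ /mem_set/Ax.
split=> [/ess_supP|H]; first by apply: filterS => x /fE.
by apply/ess_supP; apply: filterS H => x /fE.
Qed.

(** Fubini for null sets: the product measure may be computed by integrating
    the measures of the sections over either factor, and an integral of a
    nonnegative function vanishes only if the function does almost
    everywhere. *)
Lemma negligible_ysection d1 d2 (S1 : measurableType d1)
    (S2 : measurableType d2) (m1 : {sigma_finite_measure set S1 -> \bar R})
    (m2 : {sigma_finite_measure set S2 -> \bar R}) (Q : S1 -> S2 -> Prop) :
  {ae (m1 \x m2)%E, forall z, Q z.1 z.2} ->
  {ae m2, forall y, {ae m1, forall x, Q x y}}.
Proof.
move=> [A [mA A0 QA]].
have {}A0 : (m1 \x^ m2)%E A = 0%E.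
  rewrite -A0; apply/esym.
  apply: (@product_measure_unique _ _ _ _ _ m1 m2 (m1 \x^ m2)%E) => //.
  move=> B1 B2 mB1 mB2.
  exact: product_measure2E.
have := @ae_eq_integral_abs _ _ _ m2 setT measurableT (m1 \o ysection A)
  (measurable_fun_ysection m1 mA).
move=> [+ _]; case.
  by rewrite -[RHS]A0; apply: eq_integral => y _; rewrite /= gee0_abs.
move=> B [mB B0 AB]; exists B; split=> // y nQ; apply: AB => /= AB; apply: nQ.
exists (ysection A y); split; [exact: measurable_ysection|exact: AB|].
by move=> x nQ; rewrite /ysection/=; apply/mem_set/QA.
Qed.

Lemma ae_prod_snd d1 d2 (S1 : measurableType d1) (S2 : measurableType d2)
    (m1 : {sigma_finite_measure set S1 -> \bar R})
    (m2 : {sigma_finite_measure set S2 -> \bar R}) (Q : S2 -> Prop) :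
  {ae m2, forall y, Q y} -> {ae (m1 \x m2)%E, forall z, Q z.2}.
Proof.
move=> [B [mB B0 QB]]; exists (setT `*` B); split.
- exact: measurableX.
- by rewrite product_measure1E// B0 mule0.
- by move=> z nQ; split=> //; apply: QB.
Qed.

Lemma lebesgue_setT_gt0 : (0 < @lebesgue_measure R setT)%E.
Proof.
rewrite -set_itvNyy lebesgue_measure_itv/=; exact: lt0y.
Qed.

(** The L^oo norm of the library is 0 by convention on a space of measure
    zero; it is an essential supremum here by positivity of the measures. *)
Lemma lebesgue_Rn_gt0 n : (0 < @lebesgue_Rn R n setT)%E.
Proof.
elim: n => [|n IHn] /=; first by rewrite diracT lte01.
rewrite /lebesgue_cons /pushforward preimage_setT -setXTT product_measure1E//.
by apply: mule_gt0 => //; exact: lebesgue_setT_gt0.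
Qed.

Lemma lebesgue_TP_gt0 n : (0 < (lebesgue_measure \x @lebesgue_Rn R n) setT)%E.
Proof.
rewrite -setXTT product_measure1E//.
by apply: mule_gt0; [exact: lebesgue_setT_gt0|exact: lebesgue_Rn_gt0].
Qed.

End EssentialBounds.

(** * Errors sampled on time grids *)

Section GridError.
Context {R : realType}.

(** A bound that holds on a dense set of times passes to all times; the
    hypothesis asks for a good time in every nonempty open subinterval, which is
    what both null sets and fine grids provide. *)
Lemma within_itv_le (g : R -> R) (T r : R) : 0 < T ->
  {within `[0, T], continuous g} ->
  (forall a b, 0 <= a -> a < b -> b <= T -> exists2 s, a < s < b & g s <= r) ->
  forall t, 0 <= t <= T -> g t <= r.
Proof.
move=> T0 /subspace_continuousP gc H t /andP[t0 tT].
rewrite leNgt; apply/negP => rgt.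
have /gc gct : `[0, T]%classic t by rewrite /= in_itv/= t0.
have : \forall s \near within `[0, T]%classic (nbhs t), r < g s.
  exact: cvgr_gt gct _ rgt.
rewrite near_withinE near_nbhs => -[e /= e0 He].
have [s /andP[s1 s2]] : exists2 s, Num.max 0 (t - e) < s < Num.min T (t + e) &
    g s <= r.
  (* the neighbourhood of t is cut at 0 and T, which may be t itself *)
  apply: H.
  - by rewrite le_max lexx.
  - by rewrite lt_min !gt_max T0/= !ltr_pwDr ?andbT//=; lra.
  - by rewrite ge_min lexx.
rewrite leNgt => /negP; apply; move: s1 s2; rewrite gt_max lt_min.
move=> /andP[s0 ts] /andP[sT st].
apply: He; last by rewrite /= in_itv/= !ltW.
by rewrite /= ltr_distlC; lra.
Qed.

Lemma nb_steps_le (T dt : R) k : 0 <= T -> 0 < dt ->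
  (k <= nb_steps T dt)%N = (k%:R * dt <= T).
Proof.
move=> T0 dt0; rewrite truncn_ge_nat; last by rewrite divr_ge0// ltW.
by rewrite ler_pdivlMr.
Qed.

(** The first grid point beyond [a] lies within [dt] of it. *)
Lemma grid_meets (T dt a b : R) : 0 < dt -> 0 <= a -> dt < b - a -> b <= T ->
  exists2 k, (k <= nb_steps T dt)%N & a < k%:R * dt < b.
Proof.
move=> dt0 a0 dtab bT; pose k := (Num.truncn (a / dt)).+1.
have ak : a < k%:R * dt by rewrite -ltr_pdivrMr// truncnS_gt.
have kb : k%:R * dt < b.
  have : (Num.truncn (a / dt))%:R <= a / dt.
    by rewrite -truncn_ge_nat// divr_ge0// ltW.
  by rewrite ler_pdivlMr// /k -natr1 mulrDl mul1r; lra.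
by exists k; [rewrite nb_steps_le//; lra|rewrite ak].
Qed.

Lemma Linf_P_le n m (P : set 'rV[R]_n) (g : 'rV[R]_n -> 'rV[R]_m) (r : R) :
  0 <= r ->
  (Linf_P P g <= r%:E)%E <-> {ae lebesgue_Rn n,
    forall x, P (row_of_tuple x) -> enorm (g (row_of_tuple x)) <= r}.
Proof.
move=> r0; apply: Lnorm_oo_restrict_le => //; first exact: lebesgue_Rn_gt0.
by move=> v; exact: enorm_ge0.
Qed.

Lemma Linf_TP_le n m (T : R) (P : set 'rV[R]_n) (g : R -> 'rV[R]_n -> 'rV[R]_m)
    (r : R) : 0 <= r ->
  (Linf_TP T P g <= r%:E)%E <-> {ae (lebesgue_measure \x lebesgue_Rn n)%E,
    forall z, (`[0, T]%classic `*` P) (z.1, row_of_tuple z.2) ->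
      enorm (g z.1 (row_of_tuple z.2)) <= r}.
Proof.
move=> r0.
have f0 v : 0 <= (fun y : R * 'rV[R]_n => enorm (g y.1 y.2)) v.
  exact: enorm_ge0.
exact: (@Lnorm_oo_restrict_le _ _ _ (lebesgue_measure \x lebesgue_Rn n)%E
  _ (`[0, T]%classic `*` P) (fun z => (z.1, row_of_tuple z.2)) _ r
  (lebesgue_TP_gt0 n) f0 r0).
Qed.

Lemma Linf_P_ge0 n m (P : set 'rV[R]_n) (g : 'rV[R]_n -> 'rV[R]_m) :
  (0 <= Linf_P P g)%E.
Proof. exact: Lnorm_ge0. Qed.

Lemma Linf_TP_ge0 n m T (P : set 'rV[R]_n) (g : R -> 'rV[R]_n -> 'rV[R]_m) :
  (0 <= Linf_TP T P g)%E.
Proof. exact: Lnorm_ge0. Qed.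

Lemma Linf_P_perturb n m (P : set 'rV[R]_n) (g h : 'rV[R]_n -> 'rV[R]_m)
    (d : R) : 0 <= d ->
  (forall mu, P mu -> enorm (g mu) <= enorm (h mu) + d) ->
  (Linf_P P g <= Linf_P P h + d%:E)%E.
Proof.
move=> d0 gh; case hr : (Linf_P P h) (Linf_P_ge0 P h) => [r| |]; last by [].
  rewrite lee_fin => r0; rewrite -EFinD; apply/Linf_P_le; first exact: addr_ge0.
  have /Linf_P_le : (Linf_P P h <= r%:E)%E by rewrite hr.
  move=> /(_ r0); apply: filterS => x hx Px.
  by apply: le_trans (gh _ Px) _; rewrite lerD2r hx.
by move=> _; rewrite addye// leey.
Qed.

Definition grid_sup n m (T : R) (P : set 'rV[R]_n)
    (g : R -> 'rV[R]_n -> 'rV[R]_m) (dt : R) : \bar R :=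
  ereal_sup [set Linf_P P (g (k%:R * dt)) | k in
    [set k | (k <= nb_steps T dt)%N]].

Section ContinuousInTime.
Variables (n m : nat) (T : R) (P : set 'rV[R]_n).
Variable g : R -> 'rV[R]_n -> 'rV[R]_m.
Hypothesis T_gt0 : 0 < T.
Hypothesis g_cont : forall mu, P mu ->
  {within `[0, T], continuous (fun t => enorm (g t mu))}.

(** The exceptional null set of parameters does not depend on t. *)
Lemma Linf_TP_slice (r : R) : 0 <= r -> (Linf_TP T P g <= r%:E)%E ->
  {ae lebesgue_Rn n, forall x, P (row_of_tuple x) ->
    forall t, 0 <= t <= T -> enorm (g t (row_of_tuple x)) <= r}.
Proof.
move=> r0 /(Linf_TP_le _ _ _ r0) gr.
have := @negligible_ysection _ _ _ _ _ lebesgue_measure (lebesgue_Rn n)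
  (fun t x => (`[0, T]%classic `*` P) (t, row_of_tuple x) ->
     enorm (g t (row_of_tuple x)) <= r) gr.
apply: filterS => x [N [mN N0 HN]] Px.
apply: within_itv_le (g_cont Px) _ => // a b a0 ab bT.
apply: contrapT => H.
have : (lebesgue_measure (`]a, b[%classic : set R) <= lebesgue_measure N)%E.
  apply: le_measure; rewrite ?inE// => s /=; rewrite in_itv/= => sab.
  apply: HN => /= Hs; apply: H; exists s => //; apply: Hs; split => //=.
  by rewrite in_itv/=; lra.
by rewrite N0 lebesgue_measure_itv/= lte_fin ab -EFinB lee_fin; lra.
Qed.

Lemma grid_sup_le_Linf_TP dt : 0 < dt -> (grid_sup T P g dt <= Linf_TP T P g)%E.
Proof.
move=> dt0; apply: ge_ereal_sup => _ [k /= + <-].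
rewrite nb_steps_le ?(ltW T_gt0)// => kT.
case gr : (Linf_TP T P g) (Linf_TP_ge0 T P g) => [r| |] //.
  rewrite lee_fin => r0; apply/Linf_P_le => //.
  have : (Linf_TP T P g <= r%:E)%E by rewrite gr.
  move=> /(Linf_TP_slice r0); apply: filterS => x Hx Px; apply: Hx => //.
  by rewrite mulr_ge0// ltW.
by move=> _; rewrite leey.
Qed.

(** It suffices to bound the sampled error along one sequence of steps
    tending to 0: countably many null sets are discarded, and the union of the
    grids is dense. *)
Lemma Linf_TP_le_grid_sup (r : R) : 0 <= r ->
  (forall e, 0 < e -> exists2 dt, 0 < dt < e & (grid_sup T P g dt <= r%:E)%E) ->
  (Linf_TP T P g <= r%:E)%E.
Proof.
move=> r0 H; apply/Linf_TP_le => //.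
have /choice[dt dtP] (j : nat) : exists dt, 0 < dt < j.+1%:R^-1 /\
    (grid_sup T P g dt <= r%:E)%E.
  by have [|dt] := H j.+1%:R^-1; [rewrite invr_gt0|exists dt].
have : {ae lebesgue_Rn n, forall x, forall j k : nat,
    (k <= nb_steps T (dt j))%N -> P (row_of_tuple x) ->
    enorm (g (k%:R * dt j) (row_of_tuple x)) <= r}.
  apply/ae_foralln => j; apply/ae_foralln => k.
  have [kT|kT] := boolP (k <= nb_steps T (dt j))%N; last exact: aeW.
  have /(Linf_P_le _ _ r0) : (Linf_P P (g (k%:R * dt j)) <= r%:E)%E.
    by apply: le_trans (dtP j).2; apply: ereal_sup_ubound; exists k.
  by apply: filterS => x Hx _.
move=> /(ae_prod_snd lebesgue_measure); apply: filterS => -[t x] /= Hx.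
rewrite in_itv/= => -[tT Px]; move: t tT.
apply: within_itv_le (g_cont Px) _ => // a b a0 ab bT.
have [j jab] : exists j : nat, j.+1%:R^-1 < b - a.
  exists (Num.truncn (b - a)^-1); rewrite invf_plt ?posrE ?subr_gt0//.
  exact: truncnS_gt.
have [/andP[dt0 dtj] _] := dtP j.
have [k kT kab] := grid_meets dt0 a0 (lt_trans dtj jab) bT.
by exists (k%:R * dt j) => //; exact: Hx.
Qed.

Lemma grid_sup_near (r : R) : 0 <= r -> (r%:E < Linf_TP T P g)%E ->
  \forall dt \near 0^'+, (r%:E < grid_sup T P g dt)%E.
Proof.
move=> r0 rg; apply: contrapT => H; move: rg; rewrite ltNge => /negP; apply.
apply: Linf_TP_le_grid_sup => // e e0; apply: contrapT => He; apply: H.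
near=> dt; rewrite ltNge; apply/negP => dtr; apply: He; exists dt => //.
by apply/andP; split; near: dt; [exact: nbhs_right_gt|exact: nbhs_right_lt].
Unshelve. all: by end_near. Qed.

End ContinuousInTime.
End GridError.

(** * Discrete against continuous error *)

Section ErrorEstimates.
Context {R : realType}.

Lemma ereal_sup_perturb (K : set nat) (a b : nat -> \bar R) (d : R) :
  (forall k, K k -> (a k <= b k + d%:E)%E) ->
  (ereal_sup (a @` K) <= ereal_sup (b @` K) + d%:E)%E.
Proof.
move=> ab; apply: ge_ereal_sup => _ [k Kk <-].
apply: le_trans (ab k Kk) _; apply: leeD2r.
by apply: ereal_sup_ubound; exists k.
Qed.

Variables (nmu Nh n p : nat) (T : R) (P : set 'rV[R]_nmu).
Variables (u0h : 'rV[R]_nmu -> 'rV[R]_Nh) (uh : R -> 'rV[R]_nmu -> 'rV[R]_Nh).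
Variables (M : learned_model R nmu Nh n) (un : R -> 'rV[R]_nmu -> 'rV[R]_n).
Variable C' : R.
Hypothesis dec_lipschitz : elipschitz (realize (decoder M)).
Hypothesis order_p : convergent_of_order T P u0h M un p C'.

Let g t mu := uh t mu - uh_hat M un t mu.
Let C2 := elip_const (realize (decoder M)) * C'.

Lemma decoded_error_continuous mu :
  {within `[0, T], continuous (uh ^~ mu)} ->
  {within `[0, T], continuous (un ^~ mu)} ->
  {within `[0, T], continuous (fun t => enorm (g t mu))}.
Proof.
move=> /subspace_continuousP uc /subspace_continuousP nc.
apply/subspace_continuousP => t tT.
have ut : enorm (uh s mu - uh t mu) @[s --> within `[0, T] (nbhs t)] --> 0.
  exact: cvg_enorm_dist (uc t tT).
have nt : enorm (uh_hat M un s mu - uh_hat M un t mu)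
    @[s --> within `[0, T] (nbhs t)] --> 0.
  exact: elipschitz_cvg_dist dec_lipschitz (nc t tT).
have unt : enorm (uh s mu - uh t mu) +
    enorm (uh_hat M un s mu - uh_hat M un t mu)
    @[s --> within `[0, T] (nbhs t)] --> 0.
  by rewrite -[X in _ --> X](addr0 (0 : R)); exact: cvgD ut nt.
apply: cvg_zero; apply/norm_cvg0P.
refine (squeeze_cvgr _ (cvg_cst 0) unt).
apply: nearW => s; rewrite normr_ge0/= (le_trans (ler_dist_enorm _ _))//.
have -> : g s mu - g t mu =
    uh s mu - uh t mu - (uh_hat M un s mu - uh_hat M un t mu).
  by rewrite /g !opprB addrACA [RHS]addrACA [- _ - _]addrC.
rewrite -(enormN (uh_hat _ _ _ _ - _)); exact: ler_enormD.
Qed.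

Lemma C2_ge0 : 0 <= C2.
Proof. by rewrite mulr_ge0 ?elip_const_ge0//; case: order_p. Qed.

(** The error of the Runge-Kutta scheme, seen through the decoder. *)
Lemma decoded_scheme_error dt k mu : 0 < dt -> (k <= nb_steps T dt)%N -> P mu ->
  enorm (uh_hat M un (k%:R * dt) mu - uh_hat_discrete M u0h dt k mu) <=
  C2 * dt ^+ p.
Proof.
move=> dt0 kT Pmu; apply: le_trans (elip_constP dec_lipschitz _ _) _.
rewrite -mulrA ler_wpM2l ?elip_const_ge0//.
by case: order_p => _; exact.
Qed.

Lemma err_discrete_le_grid_sup dt : 0 < dt ->
  (err_discrete T P uh u0h M dt <= grid_sup T P g dt + (C2 * dt ^+ p)%:E)%E.
Proof.
move=> dt0; apply: ereal_sup_perturb => k kT.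
apply: Linf_P_perturb => [|mu Pmu].
  by rewrite mulr_ge0 ?C2_ge0 ?exprn_ge0 ?ltW.
apply: le_trans (lerD (lexx _) (decoded_scheme_error dt0 kT Pmu)).
apply: le_trans (ler_enormD _ _).
by rewrite /g addrA subrK.
Qed.

Lemma grid_sup_le_err_discrete dt : 0 < dt ->
  (grid_sup T P g dt <= err_discrete T P uh u0h M dt + (C2 * dt ^+ p)%:E)%E.
Proof.
move=> dt0; apply: ereal_sup_perturb => k kT.
apply: Linf_P_perturb => [|mu Pmu].
  by rewrite mulr_ge0 ?C2_ge0 ?exprn_ge0 ?ltW.
apply: le_trans (lerD (lexx _) (decoded_scheme_error dt0 kT Pmu)).
rewrite -(enormN (uh_hat _ _ _ _ - _)) opprB.
apply: le_trans (ler_enormD _ _).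
by rewrite /g addrA subrK.
Qed.

Lemma err_discrete_ge0 dt : (0 <= err_discrete T P uh u0h M dt)%E.
Proof.
apply: (@le_trans _ _ (Linf_P P (fun mu => uh (0%:R * dt) mu
                                     - uh_hat_discrete M u0h dt 0 mu))).
  exact: Linf_P_ge0.
by apply: ereal_sup_ubound; exists 0%N.
Qed.

(** When the latent field does not depend on the latent state, the Runge-Kutta
    iterates are the quadrature sums of the approximation theorem, whose
    pointwise bound then applies to the learned model. *)
Lemma approximation_err_discrete_le c eps dt_star
    (F : network R (1 + nmu) n) dt :
  0 < eps -> (forall mu t x, latent_rhs M mu t x = time_net_eval F mu t) ->
  approximation_data T P uh u0h c eps M F dt_star -> 0 < dt <= dt_star ->
  (err_discrete T P uh u0h M dt <= eps%:E)%E.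
Proof.
move=> eps0 FE [_ _ _ _ H] dtP; apply: ge_ereal_sup => _ [k kT <-].
apply/Linf_P_le; first exact: ltW.
apply: aeW => x Px; rewrite /uh_hat_discrete /latent_discrete.
by rewrite (rk_iterate_quadrature _ _ _ _ (FE _)); exact: H.
Qed.

Hypothesis T_gt0 : 0 < T.
Hypothesis uh_cont : forall mu, P mu -> {within `[0, T], continuous (uh ^~ mu)}.
Hypothesis un_cont : forall mu, P mu -> {within `[0, T], continuous (un ^~ mu)}.

Let E := err_discrete T P uh u0h M.
Let E0 := err_continuous T P uh M un.

Let g_cont mu (Pmu : P mu) :=
  decoded_error_continuous (uh_cont Pmu) (un_cont Pmu).

Lemma err_discrete_le dt : 0 < dt -> (E dt <= E0 + (C2 * dt ^+ p)%:E)%E.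
Proof.
move=> dt0; apply: le_trans (err_discrete_le_grid_sup dt0) _.
by apply: leeD2r; exact: grid_sup_le_Linf_TP.
Qed.

Lemma err_continuous_ge0 : (0 <= E0)%E.
Proof. exact: Linf_TP_ge0. Qed.

Lemma err_discrete_fin_num dt : (E0 < +oo)%E -> 0 < dt -> E dt \is a fin_num.
Proof.
move=> E0oo dt0; rewrite ge0_fin_numE ?err_discrete_ge0//.
by rewrite (le_lt_trans (err_discrete_le dt0))// lte_add_pinfty// ltry.
Qed.

Lemma cvg_order_term : (0 < p)%N -> C2 * dt ^+ p @[dt --> 0^'+] --> (0 : R).
Proof.
move=> p0; rewrite -[X in _ --> X](mulr0 C2); apply: cvgM; first exact: cvg_cst.
have /(cvg_at_right_filter (x := 0)) := @exprn_continuous R p 0.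
by rewrite expr0n (gtn_eqF p0).
Qed.

(** For the lower bound E(0) - e, half of [e] is spent on the scheme error
    C2 dt^p, the other half on the distance from the sampled error to E(0). *)
Lemma cvg_err_discrete : (0 < p)%N -> (E0 < +oo)%E -> E0 != 0%E ->
  fine (E dt) @[dt --> 0^'+] --> fine E0.
Proof.
move=> p0 E0oo E0n0; have E0ge := err_continuous_ge0.
have E0fin : E0 \is a fin_num by rewrite ge0_fin_numE.
have e0_gt0 : 0 < fine E0 by rewrite fine_gt0// E0oo lt0e E0n0 E0ge.
apply/cvgrPdist_lt => e e0.
(* truncated at 0 because [grid_sup_near] bounds norms by nonnegative reals;
   r < E0 still holds as E0 is nonzero *)
pose r := Num.max 0 (fine E0 - e / 2).
have r_ge0 : 0 <= r by rewrite le_max lexx.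
have rE0 : (r%:E < E0)%E by rewrite -(fineK E0fin) lte_fin gt_max e0_gt0/=; lra.
have e20 : 0 < e / 2 by rewrite divr_gt0.
have Cnear : \forall dt \near (0 : R)^'+, C2 * dt ^+ p < e / 2.
  exact: (cvgr_lt _ (cvg_order_term p0)).
near=> dt.
have dt0 : 0 < dt by near: dt; exact: nbhs_right_gt.
have Cdt : C2 * dt ^+ p < e / 2 by near: dt.
have rS : (r%:E < grid_sup T P g dt)%E.
  by near: dt; exact: (grid_sup_near T_gt0 g_cont r_ge0 rE0).
have := lt_le_trans rS (grid_sup_le_err_discrete dt0).
have := err_discrete_le dt0.
have Edt := err_discrete_fin_num E0oo dt0.
rewrite -/(E dt) -(fineK Edt) -(fineK E0fin) -!EFinD lee_fin lte_fin => h1 h2.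
have : fine E0 - e / 2 <= r by rewrite le_max lexx orbT.
by rewrite ltr_distlC; lra.
Unshelve. all: by end_near. Qed.

End ErrorEstimates.

Theorem mainTheorem8 (R : realType) (nmu Nh n p : nat) (T : R)
    (P : set 'rV[R]_nmu)
    (fh : R -> 'rV[R]_Nh -> 'rV[R]_nmu -> 'rV[R]_Nh)
    (u0h : 'rV[R]_nmu -> 'rV[R]_Nh)
    (uh : R -> 'rV[R]_nmu -> 'rV[R]_Nh)
    (M : learned_model R nmu Nh n)
    (un : R -> 'rV[R]_nmu -> 'rV[R]_n) (C' : R)
    (T_gt0 : 0 < T) (P_compact : compact P)
    (n_gt0 : (0 < n)%N) (p_gt0 : (0 < p)%N)
    (uh_C1 : C1_on (`[0, T]%classic `*` P)
               (fun z : R * 'rV[R]_nmu => uh z.1 z.2))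
    (uh_sol : forall mu, P mu ->
       ivp_solution T (fun t x => fh t x mu) (u0h mu) (uh ^~ mu))
    (un_sol : forall mu, P mu ->
       ivp_solution T (latent_rhs M mu) (latent_init M u0h mu) (un ^~ mu))
    (order_p : convergent_of_order T P u0h M un p C')
    (dec_lipschitz : elipschitz (realize (decoder M))) :
  let E := err_discrete T P uh u0h M in
  let E0 := err_continuous T P uh M un in
  let C2 := elip_const (realize (decoder M)) * C' in
  (forall dt, 0 < dt -> (E dt <= E0 + (C2 * dt ^+ p)%:E)%E) /\
  ((E0 < +oo)%E ->
    (forall dt_train, 0 < dt_train -> E dt_train != 0%E ->
       exists C : R, 0 < C /\
         (E0 + (C2 * dt_train ^+ p)%:E = C%:E * E dt_train)%E /\
         forall dt, 0 < dt <= dt_train ->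
           (E dt <= E0 + (C2 * dt_train ^+ p)%:E)%E) /\
    (perfect_embedding T P uh ->
     forall (c eps dt_star : R) (F : network R (1 + nmu) n),
       0 < eps ->
       (forall mu t x, latent_rhs M mu t x = time_net_eval F mu t) ->
       approximation_data T P uh u0h c eps M F dt_star ->
       let C := fun dt_train : R =>
         (fine E0 + C2 * dt_train ^+ p) * (fine (E dt_train))^-1 in
       (forall dt_train, 0 < dt_train <= dt_star -> E dt_train != 0%E ->
        forall dt, 0 < dt <= dt_train ->
          (E dt <= (C dt_train)%:E * E dt_train)%E /\
          ((C dt_train)%:E * E dt_train <= (C dt_train * eps)%:E)%E) /\
       (E0 != 0%E -> C dt_train @[dt_train --> 0^'+] --> (1 : R)))).
Proof.
move=> E E0 C2.
have uh_cont mu : P mu -> {within `[0, T], continuous (uh ^~ mu)}.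
  by move=> /uh_sol[].
have un_cont mu : P mu -> {within `[0, T], continuous (un ^~ mu)}.
  by move=> /un_sol[].
have EE0 dt : 0 < dt -> (E dt <= E0 + (C2 * dt ^+ p)%:E)%E.
  exact: err_discrete_le.
split=> // E0oo.
have E0fin : E0 \is a fin_num by rewrite ge0_fin_numE// err_continuous_ge0.
have Efin dt : 0 < dt -> E dt \is a fin_num.
  by apply: err_discrete_fin_num E0oo => //; exact: order_p.
have E_gt0 dt : 0 < dt -> E dt != 0%E -> 0 < fine (E dt).
  move=> dt0 En0; rewrite fine_gt0// lt0e En0 err_discrete_ge0/=.
  by rewrite -ge0_fin_numE ?err_discrete_ge0// Efin.
have EE0_train dt' dt : 0 < dt <= dt' ->
    (E dt <= E0 + (C2 * dt' ^+ p)%:E)%E.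
  move=> /andP[dt0 dtt]; apply: le_trans (EE0 _ dt0) _; apply: leeD2l.
  rewrite lee_fin ler_wpM2l ?(C2_ge0 order_p)//.
  by rewrite lerXn2r// nnegrE ltW// (lt_le_trans dt0).
pose C dt := (fine E0 + C2 * dt ^+ p) * (fine (E dt))^-1.
have CE dt : 0 < dt -> E dt != 0%E ->
    (E0 + (C2 * dt ^+ p)%:E = (C dt)%:E * E dt)%E.
  move=> dt0 En0; rewrite -{1}(fineK E0fin) -(fineK (Efin _ dt0)) -EFinM -EFinD.
  by rewrite /C mulfVK// gt_eqF// E_gt0.
have C_gt0 dt : 0 < dt -> E dt != 0%E -> 0 < C dt.
  move=> dt0 En0; rewrite /C divr_gt0 ?E_gt0//.
  apply: lt_le_trans (E_gt0 _ dt0 En0) _.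
  by rewrite -lee_fin EFinD !fineK ?Efin// EE0.
split=> [dt' dt'0 En0|_ c eps dt_star F eps0 FE HF].
  exists (C dt'); split; first exact: C_gt0.
  by split=> [|dt]; [exact: CE|exact: EE0_train].
split=> [dt' /andP[dt'0 dt's] En0 dt dtt|E0n0].
  split; first by rewrite -CE// EE0_train.
  apply: (@le_trans _ _ ((C dt')%:E * eps%:E)%E); last by rewrite -EFinM.
  apply: lee_wpmul2l; first by rewrite lee_fin; exact/ltW/C_gt0.
  by apply: (approximation_err_discrete_le eps0 FE HF); rewrite dt'0.
have E0n : fine E0 != 0 by rewrite fine_eq0.
rewrite -(mulfV E0n); apply: cvgM; last first.
  by apply: cvgV => //; exact: (cvg_err_discrete dec_lipschitz order_p).
rewrite -[X in _ --> X]addr0; apply: cvgD; first exact: cvg_cst.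
exact: (cvg_order_term M C' p_gt0).
Qed.
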